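(* Let $W_{22}:\Lambda^2(\mathbb R^9)\to\Lambda^2(\mathbb R^9)$ be a linear map. Then $W_{22}$ satisfies the integrability condition $$[\mathcal J,W_{22}(\mathrm{Ad}(\mathcal J)\omega^2)]-\mathrm{Ad}(\mathcal J)\big(W_{22}([\mathcal J,\omega^2])\big)+W_{22}([\mathcal J,\omega^2])-[\mathcal J,W_{22}(\omega^2)]=0$$ for all $\omega^2\in\Lambda^2(\mathbb R^9)$ and all $\mathcal J\in\mathcal T_1$, if and only if there exist a constant $c\in\mathbb R$, a 2-form $\eta^2\in\Lambda^2(\mathbb R^9)$ and a 5-form $\mu^5\in\Lambda^5(\mathbb R^9)$ such that $$W_{22}(\omega^2)=c\cdot\omega^2+[\eta^2,\omega^2]+\star(\mu^5\wedge\omega^2)\qquad\text{for all }\omega^2\in\Lambda^2(\mathbb R^9).$$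
   Context: Let $I_1,\dots,I_9$ be symmetric endomorphisms of Euclidean $\mathbb R^{16}$ with $I_\alpha^2=\mathrm{Id}$ and $I_\alpha I_\beta=-I_\beta I_\alpha$ for $\alpha\neq\beta$; regard them as an orthonormal basis of $\mathbb R^9$. The space $\Lambda^2(\mathbb R^9)$ is identified with the Lie algebra $\mathfrak{spin}(9)=\mathrm{Lin}(I_\alpha I_\beta:\alpha<\beta)\subset\mathfrak{so}(16)$ via $I_\alpha\wedge I_\beta\mapsto I_\alpha I_\beta$ ($\alpha\neq\beta$), and $[\cdot,\cdot]$ is the commutator of endomorphisms. $\mathcal T_1=\{\mathcal J=\sum_{\alpha<\beta}x_{\alpha\beta}I_\alpha I_\beta:\ x_{\alpha\beta}\in\mathbb R,\ \mathcal J^2=-\mathrm{Id}\}$; every $\mathcal J\in\mathcal T_1$ also lies in the group $Spin(9)\subset SO(16)$, and $\mathrm{Ad}(\mathcal J)\omega^2=\mathcal J\omega^2\mathcal J^{-1}$. $\star$ is the Hodge operator of $\mathbb R^9$. *)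

(* Defs.v *)
From HB Require Import structures.
From mathcomp Require Import all_boot all_order all_algebra ring.

Set Implicit Arguments.
Unset Strict Implicit.
Unset Printing Implicit Defensive.

Import GRing.Theory Num.Theory.
Local Open Scope ring_scope.

Notation ksub n k := {S : {set 'I_n} | #|S| == k%N}.

(* Lambda^k(R^n), in coordinates with respect to the basis
   e_S = e_(s_1) /\ ... /\ e_(s_k), S = {s_1 < ... < s_k}, where (e_i) is the
   standard positively oriented orthonormal basis of R^n. *)
Notation Lambda R n k := {ffun ksub n k -> R^o}.

Section Exterior.
Context {R : fieldType} {n : nat}.

Definition coef {k : nat} (u : Lambda R n k) (S : {set 'I_n}) : R :=
  if insub S is Some s then u s else 0.

(* The sign such that e_S /\ e_T = shuffle_sign S T *: e_(S :|: T) for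
   disjoint S and T, i.e. (-1) to the number of inversions. *)
Definition shuffle_sign (S T : {set 'I_n}) : R :=
  (-1) ^+ #|[set ij in setX S T | (ij.2 < ij.1)%N]|.

Definition wedge {k l : nat} (u : Lambda R n k) (v : Lambda R n l) :
    Lambda R n (k + l)%N :=
  [ffun U => \sum_(S : ksub n k)
     \sum_(T : ksub n l | [disjoint val S & val T]
                          && (val S :|: val T == val U))
       shuffle_sign (val S) (val T) * (u S * v T)].

(* Normalized by e_S /\ hodge e_S = e_0 /\ ... /\ e_(n-1), that is
   hodge e_S = shuffle_sign S (~: S) *: e_(~: S). *)
Definition hodge {k : nat} (u : Lambda R n k) : Lambda R n (n - k)%N :=
  [ffun T => shuffle_sign (~: val T) (val T) * coef u (~: val T)].

End Exterior.

(* Endomorphisms of Euclidean R^16 are written as matrices in its standard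
   orthonormal basis. *)
Definition clifford9 (R : fieldType) (I : 'I_9 -> 'M[R]_16) : Prop :=
  [/\ forall a, (I a)^T = I a,
      forall a, I a *m I a = 1%:M
    & forall a b, a != b -> I a *m I b = - (I b *m I a)].

Section Spin9.
Context {R : fieldType}.
Variable I : 'I_9 -> 'M[R]_16.

(* The identification of Lambda^2(R^9) with spin(9) inside so(16), mapping
   I_a /\ I_b = e_a /\ e_b to the composition I_a I_b for a <> b. *)
Definition spin9 (w : Lambda R 9 2) : 'M[R]_16 :=
  \sum_(a < 9) \sum_(b < 9 | (a < b)%N) coef w [set a; b] *: (I a *m I b).

(* Inverse of spin9 on its range: see spin9K, spin9_lie and spin9_Ad. *)
Definition spin9_inv : 'M[R]_16 -> Lambda R 9 2 := (linfun spin9)^-1%VF.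

Definition lie (u v : Lambda R 9 2) : Lambda R 9 2 :=
  spin9_inv (spin9 u *m spin9 v - spin9 v *m spin9 u).

Definition T1 (J : Lambda R 9 2) : Prop := spin9 J *m spin9 J = - 1%:M.

(* For J in T1 the conjugate lies in the range of spin9 (spin9_Ad). *)
Definition Ad (J w : Lambda R 9 2) : Lambda R 9 2 :=
  spin9_inv (spin9 J *m spin9 w *m invmx (spin9 J)).

Lemma coef_val (k : nat) (u : Lambda R 9 k) (s : ksub 9 k) : coef u (val s) = u s.
Proof. by rewrite /coef valK. Qed.

Lemma coef_is_linear (k : nat) S :
  linear ((fun u => coef u S) : Lambda R 9 k -> R^o).
Proof.
move=> c u v; rewrite /coef; case: insubP => [s _ _|_]; first by rewrite !ffunE.
by rewrite scaler0 addr0.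
Qed.

Lemma spin9_is_linear : linear spin9.
Proof.
move=> c u v; rewrite /spin9 scaler_sumr -big_split; apply: eq_bigr => a _ /=.
rewrite scaler_sumr -big_split; apply: eq_bigr => b _ /=.
by rewrite coef_is_linear scalerDl scalerA.
Qed.

HB.instance Definition _ := GRing.isLinear.Build R _ _ _ spin9 spin9_is_linear.

End Spin9.

Section Spin9Theory.
Variables (R : numFieldType) (I : 'I_9 -> 'M[R]_16).
Hypothesis hI : clifford9 I.

Let cliffordE a b : I a *m I b = (a == b)%:R *+ 2 *: 1%:M - I b *m I a.
Proof.
case: hI => _ sqI antiI; have [<-|ab] := eqVneq a b.
  by rewrite sqI -[X in _ - X]scale1r -scalerBl mulr2n addrK scale1r.
by rewrite mul0rn scale0r sub0r antiI.
Qed.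

Let tr_ortho (a b c d : 'I_9) : (a < b)%N -> (c < d)%N ->
  \tr (I a *m I b *m (I c *m I d)) = - 16%:R *+ ((a == c) && (b == d)).
Proof.
move=> ab cd; case: hI => _ sqI antiI.
have neq (x y : 'I_9) : (x < y)%N -> x != y by move=> xy; rewrite neq_ltn xy.
pose sg (k x : 'I_9) : R := if x == k then 1 else -1.
have comI k x : I k *m I x = sg k x *: (I x *m I k).
  rewrite /sg; have [->|kx] := eqVneq x k; first by rewrite scale1r.
  by rewrite antiI 1?eq_sym // scaleN1r.
have com2 k x y : I k *m (I x *m I y) = (sg k x * sg k y) *: (I x *m I y *m I k).
  by rewrite mulmxA comI -scalemxAl -mulmxA comI -scalemxAr !mulmxA scalerA.
have tr0 k : sg k a * sg k b * (sg k c * sg k d) = -1 ->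
    \tr (I a *m I b *m (I c *m I d)) = 0.
  move=> sgk; set B := _ *m _.
  have kB : I k *m B = - (B *m I k).
    rewrite /B mulmxA com2 -scalemxAl -[_ *m I k *m _]mulmxA com2 -scalemxAr.
    by rewrite scalerA sgk scaleN1r !mulmxA.
  have trB : \tr B = - \tr B.
    rewrite -{1}[B]mulmx1 -(sqI k) mulmxA mxtrace_mulC mulmxA kB mulNmx.
    by rewrite -mulmxA sqI mulmx1 raddfN.
  by apply/eqP; move/eqP: trB; rewrite -subr_eq0 opprK -mulr2n mulrn_eq0.
have [|] := boolP ((a == c) && (b == d)).
  case/andP=> /eqP <- /eqP <-.
  rewrite mulmxA -(mulmxA (I a)) (antiI b a) 1?eq_sym ?neq //.
  rewrite mulmxN mulNmx mulmxA sqI mul1mx sqI.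
  by rewrite raddfN /= mxtrace1 mulr1n.
rewrite negb_and mulr0n => acbd.
have: exists k, sg k a * sg k b * (sg k c * sg k d) = -1.
  have ab' := neq _ _ ab; have cd' := neq _ _ cd; rewrite /sg.
  have [ac|ac] := eqVneq a c; first move: acbd; rewrite ?ac ?eqxx /=.
    move=> bd; exists b; rewrite eqxx -ac (negPf ab') eq_sym (negPf bd).
    by rewrite !(mulr1, mul1r, mulrNN) // mulN1r.
  have [ad|ad] := eqVneq a d; last first.
    exists a; rewrite eqxx ![_ == a]eq_sym (negPf ab') (negPf ac) (negPf ad).
    by rewrite mul1r mulrNN mul1r mulr1.
  exists c; rewrite eqxx -ad (negPf ac).
  have -> : (b == c) = false.
    by apply/negbTE; rewrite neq_ltn orbC (ltn_trans cd) // -ad.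
  by rewrite mulrNN mulr1 mul1r mul1r.
by case=> k /tr0.
Qed.

Lemma spin9_inj : injective (spin9 I).
Proof.
apply: raddf_inj => w w0; apply/ffunP=> s; rewrite ffunE -coef_val.
suff coef0 (c d : 'I_9) : (c < d)%N -> coef w [set c; d] = 0.
  have s2 : #|val s| == 2%N := valP s.
  move: s2.
  case/cards2P=> c [d [cd ->]].
  by move: cd; rewrite neq_ltn => /orP[/coef0//|/coef0]; rewrite setUC.
move=> ltcd.
have /(congr1 mxtrace) : spin9 I w *m (I c *m I d) = 0 by rewrite w0 mul0mx.
rewrite /spin9 mulmx_suml raddf_sum /= (bigD1 c) //= [X in _ + X]big1; last first.
  move=> a /negPf ac; rewrite mulmx_suml raddf_sum big1 //= => b ab.
  by rewrite -scalemxAl linearZ /= tr_ortho // ac mulr0.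
rewrite mulmx_suml raddf_sum /= (bigD1 d) //= [X in _ + X + _]big1; last first.
  move=> b /andP[cb /negPf bd].
  by rewrite -scalemxAl linearZ /= tr_ortho // bd andbF mulr0.
rewrite -scalemxAl linearZ /= tr_ortho // !eqxx !addr0 linear0 => /eqP.
by rewrite mulf_eq0 oppr_eq0 pnatr_eq0 orbF => /eqP.
Qed.

Let lspin := linfun (spin9 I).

Let lspin_inj : lker lspin == 0%VS.
Proof. by apply/lker0P => u v; rewrite !lfunE; apply: spin9_inj. Qed.

Lemma spin9K : cancel (spin9 I) (spin9_inv I).
Proof. by move=> w; rewrite /spin9_inv -(lfunE (spin9 I)) lker0_lfunK. Qed.

Let spin9_invK M : M \in limg lspin -> spin9 I (spin9_inv I M) = M.
Proof. by move=> ?; rewrite -(lfunE (spin9 I)) limg_lfunVK. Qed.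

Let spin9_memv w : spin9 I w \in limg lspin.
Proof. by rewrite -(lfunE (spin9 I)) memv_img ?memvf. Qed.

Let S a b : 'M[R]_16 := I a *m I b - (a == b)%:R *: 1%:M.

Let S_anti a b : S b a = - S a b.
Proof.
rewrite /S [I b *m I a]cliffordE (eq_sym b) mulr2n scalerDl.
by rewrite addrAC addrK opprB.
Qed.

Let S_memv a b : S a b \in limg lspin.
Proof.
wlog: a b / (a <= b)%N => [IH|].
  have [/IH//|/ltnW/IH] := leqP a b.
  by rewrite S_anti rpredN.
rewrite leq_eqVlt => /orP[/eqP/val_inj->|ab].
  by case: hI => _ sqI _; rewrite /S sqI eqxx scale1r subrr rpred0.
have ab_card : #|[set a; b]| == 2%N by rewrite cards2 neq_ltn ab.
pose s : ksub 9 2 := Sub [set a; b] ab_card.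
pose w : Lambda R 9 2 := [ffun t => (t == s)%:R].
suff <- : spin9 I w = S a b by apply: spin9_memv.
have wE (c d : 'I_9) : (c < d)%N ->
    coef w [set c; d] = ((c == a) && (d == b))%:R.
  move=> cd; have cd_card : #|[set c; d]| == 2%N by rewrite cards2 neq_ltn cd.
  rewrite -[[set c; d]](SubK (ksub 9 2) cd_card) coef_val ffunE; congr (_%:R).
  rewrite -val_eqE /=; congr nat_of_bool; apply/eqP/andP => [/setP E|[/eqP-> /eqP->]//].
  have := E c; have := E d; rewrite !inE !eqxx orbT /= => /esym dE /esym cE.
  case/orP: cE => /eqP ca; case/orP: dE => /eqP db; move: cd ab;
    rewrite ca db ?ltnn ?eqxx // => ba ab'.
  by have := ltn_trans ba ab'; rewrite ltnn.
rewrite /spin9 /S (bigD1 a) //= [X in _ + X]big1; last first.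
  by move=> c /negPf ca; apply: big1 => d cd; rewrite wE // ca scale0r.
rewrite (bigD1 b) //= [X in _ + X + _]big1; last first.
  by move=> d /andP[ad /negPf db]; rewrite wE // db andbF scale0r.
have /negPf-> : a != b by rewrite neq_ltn ab.
by rewrite wE // !eqxx scale1r scale0r subr0 !addr0.
Qed.

Let comm_memv u v :
  spin9 I u *m spin9 I v - spin9 I v *m spin9 I u \in limg lspin.
Proof.
pose br (A B : 'M[R]_16) := A *m B - B *m A.
have brE A B : br A B = A *m B - B *m A by [].
have br_suml J (r : seq J) P F B :
    br (\sum_(i <- r | P i) F i) B = \sum_(i <- r | P i) br (F i) B.
  by rewrite /br mulmx_suml mulmx_sumr sumrB.
have br_sumr J (r : seq J) P F A :
    br A (\sum_(i <- r | P i) F i) = \sum_(i <- r | P i) br A (F i).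
  by rewrite /br mulmx_suml mulmx_sumr sumrB.
rewrite -brE /spin9 br_suml; apply: rpred_sum => a _.
rewrite br_suml; apply: rpred_sum => b _.
rewrite br_sumr; apply: rpred_sum => c _.
rewrite br_sumr; apply: rpred_sum => d _.
set x := coef _ _; set y := coef _ _.
have -> : br (x *: (I a *m I b)) (y *: (I c *m I d)) =
    (x * y) *: br (I a *m I b) (I c *m I d).
  rewrite /br -!scalemxAl -!scalemxAr !scalerA scalerBr.
  by rewrite [y * x]mulrC.
apply: rpredZ.
pose del (i j : 'I_9) : R := (i == j)%:R *+ 2.
have ad1 k : br (I a *m I b) (I k) = del b k *: I a - del a k *: I b.
  rewrite /br -mulmxA (cliffordE b k) mulmxBr -scalemxAr mulmx1.
  rewrite [X in _ - X]mulmxA [I k *m I a]cliffordE mulmxBl -scalemxAl mul1mx.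
  rewrite /del !mulmxA [k == a]eq_sym opprB addrA.
  by rewrite -[_ - _ + _]addrA addNr addr0.
have -> : br (I a *m I b) (I c *m I d) =
    del b c *: S a d - del a c *: S b d + del b d *: S c a - del a d *: S c b.
  have -> : br (I a *m I b) (I c *m I d) =
      br (I a *m I b) (I c) *m I d + I c *m br (I a *m I b) (I d).
    rewrite /br; set X := I a *m I b.
    by rewrite mulmxBl mulmxBr !mulmxA addrA subrK.
  rewrite !ad1 mulmxBl mulmxBr -!scalemxAl -!scalemxAr /S /del.
  rewrite [c == a]eq_sym [c == b]eq_sym.
  move: (I a *m I d) (I b *m I d) (I c *m I a) (I c *m I b) => M1 M2 M3 M4.
  by apply/matrixP=> i j; rewrite !mxE; ring.
by apply: rpredB; [apply: rpredD; [apply: rpredB|]|]; rewrite rpredZ.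
Qed.

Lemma spin9_lie u v :
  spin9 I (lie I u v) = spin9 I u *m spin9 I v - spin9 I v *m spin9 I u.
Proof. exact: spin9_invK. Qed.

Lemma spin9_Ad J w : T1 I J ->
  spin9 I (Ad I J w) = spin9 I J *m spin9 I w *m invmx (spin9 I J).
Proof.
move=> JJ; rewrite /Ad spin9_invK //.
have JN : spin9 I J *m (- spin9 I J) = 1%:M by rewrite mulmxN JJ opprK.
have [Ju _] := mulmx1_unit JN.
have -> : invmx (spin9 I J) = - spin9 I J.
  by rewrite -[RHS]mul1mx -(mulVmx Ju) -mulmxA JN mulmx1.
have -> : spin9 I J *m spin9 I w *m - spin9 I J =
    spin9 I w + 2^-1 *: spin9 I (lie I J (lie I J w)).
  rewrite !spin9_lie mulmxBr mulmxBl !mulmxA JJ -[spin9 I w *m _ *m _]mulmxA JJ.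
  rewrite !mulmxN mulNmx mul1mx mulmx1.
  move: (spin9 I w) (_ *m _) => M1 M2.
  by apply/matrixP=> i j; rewrite !mxE; field.
by rewrite rpredD ?rpredZ ?spin9_memv.
Qed.

End Spin9Theory.

(* Main.v *)
(* Write D = [J, .]. For J in T_1 one has D^3 = -4 D and Ad(J) = 1 + D^2 / 2, so
   the integrability condition reads D W D^2 = D^2 W D, or, for the invariant
   scalar product, <W D^2 u, D v> = - <W D u, D^2 v>.

   Sufficiency: each of the three kinds of W has <W u, v> equal to
   tr(F u v) + tr(G v u) for constant 16 x 16 matrices F and G; for the last one
   F is the Clifford element of the 4-form dual to mu. Such forms satisfy the
   condition because J anticommutes with D u and D v.

   Necessity: it suffices to use J = I_a I_b. With
   g(a,b,c,d) = <W (e_a /\ e_b), e_c /\ e_d>, the condition says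
   g(a,c,b,d) = - g(b,c,a,d) and g(a,c,a,d) = g(b,c,b,d) for c, d not in {a,b}.
   Hence g is a totally alternating 4-tensor on distinct indices (this is mu),
   g(a,c,a,d) does not depend on a and is antisymmetric in c <> d (this is eta),
   and g(a,b,a,b) is a constant (this is c). *)
From HB Require Import structures.
Require Import Defs.
From mathcomp Require Import all_boot all_order all_algebra.
From mathcomp Require Import reals ring.
Import GRing.Theory Num.Theory.
Local Open Scope ring_scope.

Set Implicit Arguments.
Unset Strict Implicit.

(** * Signs of sequences and shuffles *)

Section InversionSign.
Context {R : fieldType} {n : nat}.
Implicit Types (x y : 'I_n) (l p q : seq 'I_n) (S T U : {set 'I_n}).

(* The sign of an inversion; the value on the diagonal is 1. *)
Definition ord_sign x y : R := (-1) ^+ (y < x)%N.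

Fixpoint inv_sign l : R :=
  if l is x :: l' then (\prod_(y <- l') ord_sign x y) * inv_sign l' else 1.

Lemma ord_signC x y : x != y -> ord_sign y x = - ord_sign x y.
Proof.
rewrite /ord_sign neq_ltn => /orP[] xy; rewrite xy ltnNge (ltnW xy) /=.
  by rewrite expr0 expr1.
by rewrite expr0 expr1 opprK.
Qed.

Lemma ord_sign_sqr x y : ord_sign x y * ord_sign x y = 1.
Proof. by rewrite -signr_addb addbb. Qed.

Lemma inv_sign_sqr l : inv_sign l * inv_sign l = 1.
Proof.
elim: l => [|x l IH] /=; first by rewrite mulr1.
rewrite mulrACA IH mulr1 -big_split /= big1 // => y _.
exact: ord_sign_sqr.
Qed.

Lemma inv_sign_swap p x y q : x != y ->
  inv_sign (p ++ x :: y :: q) = - inv_sign (p ++ y :: x :: q).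
Proof.
move=> xy; elim: p => [|z p IH] /=.
  rewrite !big_cons (ord_signC xy) !mulNr opprK -!mulrA; congr (_ * _).
  by rewrite mulrCA.
rewrite IH mulrN; congr (- (_ * _)).
by rewrite !big_cat !big_cons /= [ord_sign z x * _]mulrCA.
Qed.

Lemma inv_sign_cat p q :
  inv_sign (p ++ q) =
  inv_sign p * inv_sign q * \prod_(x <- p) \prod_(y <- q) ord_sign x y.
Proof.
elim: p => [|x p IH] /=; first by rewrite big_nil mul1r mulr1.
by rewrite big_cons IH big_cat /=; ring.
Qed.

Lemma shuffle_signE S T :
  shuffle_sign S T = \prod_(x in S) \prod_(y in T) ord_sign x y :> R.
Proof.
rewrite pair_big_dep /= prodrXr /shuffle_sign -sum1_card; congr (_ ^+ _).
rewrite [LHS]big_mkcond [RHS]big_mkcond /=; apply: eq_bigr => -[x y] _.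
by rewrite !inE /=; case: (x \in S); case: (y \in T); case: (y < x)%N.
Qed.

Lemma shuffle_sign_sqr S T : shuffle_sign S T * shuffle_sign S T = 1 :> R.
Proof.
by rewrite /shuffle_sign -expr2 -exprM mulnC exprM sqrrN expr1n expr1n.
Qed.

(** Both sides are the product of [ord_sign x y] over the pairs from S × T, S × U and T × U. This is
    associativity of the wedge product on basis forms. *)
Lemma shuffle_signA S T U :
    [disjoint S & T] -> [disjoint T & U] ->
  shuffle_sign (S :|: T) U * shuffle_sign S T =
  shuffle_sign S (T :|: U) * shuffle_sign T U :> R.
Proof.
move=> ST TU; have prodU (A B : {set 'I_n}) F : [disjoint A & B] ->
    \prod_(x in A :|: B) F x = (\prod_(x in A) F x) * \prod_(x in B) F x :> R.
  by move=> AB; rewrite -bigU //; apply: eq_bigl => x; rewrite !inE.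
rewrite !shuffle_signE prodU //.
under [X in _ = X * _]eq_bigr do rewrite prodU //.
by rewrite big_split /= mulrC mulrA.
Qed.

Lemma inv_sign_shuffle p q : uniq p -> uniq q ->
  inv_sign (p ++ q) =
  inv_sign p * inv_sign q * shuffle_sign [set x in p] [set x in q].
Proof.
move=> up uq; rewrite inv_sign_cat shuffle_signE big_uniq //=; congr (_ * _).
rewrite [RHS](eq_bigl (mem p)) => [|x]; last by rewrite inE.
apply: eq_bigr => x _; rewrite big_uniq //=.
by apply: eq_bigl => y; rewrite inE.
Qed.

(** Only duplicate-free lists are constrained, so that Clifford products qualify: they do not vanish
    on repeated indices, since I_a^2 = 1. *)
Definition alternating {V : lmodType R} (X : seq 'I_n -> V) :=
  forall p x y q, uniq (p ++ x :: y :: q) ->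
    X (p ++ x :: y :: q) = - X (p ++ y :: x :: q).

(** After multiplication by [inv_sign], [X] is invariant under adjacent transpositions, hence under
    all permutations, so it depends only on the underlying set. *)
Lemma alternatingE (V : lmodType R) (X : seq 'I_n -> V) : alternating X ->
  exists N : {set 'I_n} -> V,
    forall l, uniq l -> X l = inv_sign l *: N [set x in l].
Proof.
move=> altX; pose K l := inv_sign l *: X l.
have Kswap p x y q : uniq (p ++ x :: y :: q) ->
    K (p ++ x :: y :: q) = K (p ++ y :: x :: q).
  move=> u; rewrite /K altX // inv_sign_swap ?scalerN ?scaleNr ?opprK //.
  by apply: contraTneq u => ->; rewrite cat_uniq /= mem_head !andbF.
have Kmove p x l q : uniq (p ++ x :: l ++ q) ->
    K (p ++ x :: l ++ q) = K (p ++ l ++ x :: q).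
  elim: l p => [|y l IH] p //= u.
  rewrite Kswap // -cat_rcons -[in RHS]cat_rcons; apply: IH.
  rewrite cat_rcons -(perm_uniq (_ : perm_eq (p ++ x :: y :: l ++ q) _)) //.
  by rewrite perm_cat2l (perm_catCA [:: x] [:: y]).
(* Induction on [l]: its head is located in [l'] and carried there by [Kmove]. The prefix [p]
   collects the entries already placed. *)
have Kperm l l' p : perm_eq l l' -> uniq (p ++ l) -> K (p ++ l) = K (p ++ l').
  elim: l l' p => [|x l IH] l' p ll'.
    by move: ll'; rewrite perm_sym => /perm_nilP->.
  have xl' : x \in l' by rewrite -(perm_mem ll') mem_head.
  case/splitPr: xl' ll' => l1 l2 ll' u.
  have ll2 : perm_eq l (l1 ++ l2).
    by rewrite -(perm_cons x) (perm_trans ll') // (perm_catCA l1 [:: x]).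
  have u' : uniq (p ++ x :: l1 ++ l2).
    rewrite -(perm_uniq (_ : perm_eq (p ++ x :: l) _)) //.
    by rewrite perm_cat2l perm_cons.
  by rewrite -Kmove // -!cat_rcons; apply: IH; rewrite ?cat_rcons.
exists (fun S => K (enum S)) => l u.
rewrite -(Kperm l (enum [set x in l]) [::]) //.
  by rewrite /K scalerA inv_sign_sqr scale1r.
apply: uniq_perm; rewrite ?enum_uniq // => x.
by rewrite mem_enum inE.
Qed.

End InversionSign.

(** * Decomposable 2-forms and the scalar product on 2-forms *)

Section Bivectors.
Context {R : fieldType}.
Implicit Types (a b c d : 'I_9) (u v w : Lambda R 9 2).

(* The decomposable 2-form e_a /\ e_b, which is 0 for a = b. *)
Definition bivec a b : Lambda R 9 2 :=
  [ffun s => if val s == [set a; b] then ord_sign a b else 0].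

Lemma bivecC a b : bivec b a = - bivec a b.
Proof.
apply/ffunP=> s; rewrite !ffunE setUC.
case: eqP => [sab|_]; last by rewrite oppr0.
apply: ord_signC; have := valP s; rewrite /= sab cards2.
by case: (a == b).
Qed.

Lemma coef_bivec a b (S : {set 'I_9}) : a != b ->
  coef (bivec a b) S = if S == [set a; b] then ord_sign a b else 0.
Proof.
move=> ab; rewrite /coef; case: insubP => [s _ <-|]; first by rewrite ffunE.
by move=> nS; case: ifP nS => // /eqP->; rewrite cards2 ab.
Qed.

Lemma coef_card (k : nat) (u : Lambda R 9 k) (U : {set 'I_9}) : #|U| = k ->
  exists2 s : ksub 9 k, val s = U & coef u U = u s.
Proof.
move=> /eqP Uk; exists (Sub U Uk) => //.
by rewrite -[in LHS](SubK (ksub 9 k) Uk) coef_val.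
Qed.

Lemma coef_pair u c d : c != d ->
  exists2 s : ksub 9 2, val s = [set c; d] & coef u [set c; d] = u s.
Proof. by move=> cd; apply: coef_card; rewrite cards2 cd. Qed.

(** Bivectors span: the basis form of {a, b} is [ord_sign a b] times [bivec a b], because a sign is
    its own inverse. *)
Lemma bivec_ind (P : Lambda R 9 2 -> Prop) :
  (forall x u v, P u -> P v -> P (x *: u + v)) ->
  (forall a b, a != b -> P (bivec a b)) -> forall w, P w.
Proof.
move=> Plin Pbiv w.
have P0 : P 0.
  (* Zero is reached as -1 times a bivector plus the same bivector. *)
  by rewrite -(addNr (bivec 0 1)) -scaleN1r; apply: Plin; apply: Pbiv.
have Pbasis (s : ksub 9 2) : P [ffun t => (t == s)%:R].
  have /cards2P[a [b [ab sab]]] : #|val s| == 2%N := valP s.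
  suff -> : [ffun t => (t == s)%:R] = ord_sign a b *: bivec a b + 0.
    exact: Plin (Pbiv _ _ ab) P0.
  apply/ffunP=> t; rewrite addr0 !ffunE -val_eqE /= sab.
  by case: eqP => _; rewrite ?scaler0 // [LHS]/=; rewrite -(ord_sign_sqr a b).
have -> : w = \sum_s w s *: [ffun t => (t == s)%:R] :> Lambda R 9 2.
  apply/ffunP=> t; rewrite sum_ffunE (bigD1 t) //= big1 => [|s ts].
    by rewrite !ffunE eqxx addr0 [RHS]mulr1.
  by rewrite !ffunE eq_sym (negPf ts) scaler0.
elim/big_rec: _ => // s u _ Pu; exact: Plin.
Qed.

Lemma set2_eq a b c d :
  [set a; b] = [set c; d] -> (a = c /\ b = d) \/ (a = d /\ b = c).
Proof.
move=> /setP E; move: (E a) (E b) (E c) (E d); rewrite !inE !eqxx !orbT /=.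
move=> /esym/orP[]/eqP-> /esym/orP[]/eqP->; rewrite ?eqxx ?orbb ?orbF;
  do ?[by left | by right].
  by move=> _ /eqP->; left.
by move=> /eqP->; left.
Qed.

Definition dot u v : R := \sum_s u s * v s.

Lemma dotC u v : dot u v = dot v u.
Proof. by apply: eq_bigr => s _; rewrite mulrC. Qed.

Lemma dot_is_linear u : scalar (dot u).
Proof.
move=> x v w; rewrite /dot big_distrr -big_split; apply: eq_bigr => s _ /=.
by rewrite !ffunE mulrDr mulrCA.
Qed.

HB.instance Definition _ u :=
  GRing.isLinear.Build R (Lambda R 9 2) R *%R (dot u) (dot_is_linear u).

Lemma dot_bivec u c d : c != d ->
  dot u (bivec c d) = ord_sign c d * coef u [set c; d].
Proof.
move=> cd; have [s sE ->] := coef_pair u cd.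
rewrite /dot (bigD1 s) //= big1 => [|t ts].
  by rewrite ffunE sE eqxx addr0 mulrC.
by rewrite ffunE -sE val_eqE (negPf ts) mulr0.
Qed.

End Bivectors.

(** * Linearity of the bracket *)

Section LieLinear.
Context {R : fieldType}.
Variable I : 'I_9 -> 'M[R]_16.

Lemma lie_is_linear u : linear (lie I u).
Proof.
move=> x v w; rewrite /lie /spin9_inv -linearP; congr (_ _).
rewrite linearP /= !mulmxE mulrDr mulrDl -scalerAr -scalerAl scalerBr.
by rewrite opprD addrACA.
Qed.

HB.instance Definition _ u :=
  GRing.isLinear.Build R _ _ _ (lie I u) (lie_is_linear u).

End LieLinear.

(** * Clifford products, their traces, and brackets of bivectors *)

Section Clifford.
Context {R : numFieldType}.
Variable I : 'I_9 -> 'M[R]_16.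
Hypothesis hI : clifford9 I.
Implicit Types (a b c d k : 'I_9) (l m : seq 'I_9) (u v w J : Lambda R 9 2).

Definition cliffprod l : 'M[R]_16 := \prod_(i <- l) I i.

Lemma clifford_sqr a : I a * I a = 1.
Proof. by case: hI => _ sqI _; apply: sqI. Qed.

Lemma cliffordC a b : a != b -> I a * I b = - (I b * I a).
Proof. by case: hI => _ _; apply. Qed.

Lemma cliffprod_cat l1 l2 : cliffprod (l1 ++ l2) = cliffprod l1 * cliffprod l2.
Proof. by rewrite /cliffprod big_cat. Qed.

(** Passing [I k] across a factor costs a sign unless that factor is [I k] itself. *)
Lemma cliffprod_comm k l :
  I k * cliffprod l = (-1) ^+ (size l + count_mem k l) *: (cliffprod l * I k).
Proof.
elim: l => [|a l IH]; first by rewrite /cliffprod big_nil mul1r mulr1 scale1r.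
rewrite /cliffprod big_cons -/(cliffprod l) /=.
have [->|ak] := eqVneq a k.
  rewrite {1}IH -scalerAr mulrA add1n addSn addnS !exprS.
  by rewrite !mulN1r opprK.
rewrite add0n mulrA cliffordC 1?eq_sym // mulNr -[I a * I k * _]mulrA IH.
by rewrite -scalerAr mulrA addSn exprS mulN1r scaleNr.
Qed.

(** Under these parities [I k] anticommutes with the product, while conjugation by [I k] preserves
    the trace; so the trace equals its own opposite. *)
Lemma mxtrace_cliffprod0 k l :
  ~~ odd (size l) -> odd (count_mem k l) -> \tr (cliffprod l) = 0.
Proof.
move=> sl kl; have := cliffprod_comm k l.
rewrite -signr_odd oddD (negPf sl) kl expr1 scaleN1r => kC.
have trN : \tr (cliffprod l) = - \tr (cliffprod l).
  rewrite -[in LHS](mulr1 (cliffprod l)) -(clifford_sqr k) mulrA -mulmxE.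
  rewrite mxtrace_mulC mulmxE mulrA kC mulNr -mulrA clifford_sqr mulr1.
  by rewrite raddfN.
by apply/eqP; move/eqP: trN; rewrite -subr_eq0 opprK -mulr2n mulrn_eq0.
Qed.

(** If every index had even multiplicity in [m ++ l], each entry of [m] would occur in [l], and
    equal lengths would make [l] a rearrangement of [m]. So some index has odd multiplicity and
    [mxtrace_cliffprod0] applies. *)
Lemma mxtrace_cliffprod_cat m l : uniq m -> size m = size l ->
  ~~ (uniq l && ([set x in m] == [set x in l])) -> \tr (cliffprod (m ++ l)) = 0.
Proof.
move=> um sml ml; have [k kml] : exists k, odd (count_mem k (m ++ l)).
  apply/existsP; apply: contraR ml; rewrite negb_exists => /forallP odd0.
  have sub_ml : {subset m <= l}.
    move=> k km; have := odd0 k; rewrite count_cat oddD count_uniq_mem // km /=.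
    by rewrite negbK => kl; rewrite -has_pred1 has_count; case: count kl.
  have lem : (size l <= size m)%N by rewrite sml.
  rewrite (leq_size_uniq um sub_ml lem) /=; apply/eqP/setP=> k; rewrite !inE.
  by have [_ ->] := uniq_min_size um sub_ml lem.
by apply: mxtrace_cliffprod0 kml; rewrite size_cat sml addnn odd_double.
Qed.

Lemma cliffprod_alternating : alternating cliffprod.
Proof.
move=> p a b q upq; rewrite /cliffprod !big_cat !big_cons /=.
rewrite [I a * _]mulrA cliffordC ?mulNr ?mulrN ?mulrA //.
by apply: contraTneq upq => ->; rewrite cat_uniq /= mem_head !andbF.
Qed.

Lemma spin9_bivec a b : a != b -> spin9 I (bivec a b) = I a * I b.
Proof.
wlog ab : a b / (a < b)%N => [IH|_].
  rewrite neq_ltn => /orP[] ab; first by rewrite IH // neq_ltn ab.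
  rewrite bivecC raddfN /= IH //; last by rewrite neq_ltn ab.
  by rewrite [RHS]cliffordC // neq_ltn ab orbT.
have ab' : a != b by rewrite neq_ltn ab.
have sab : ord_sign a b = 1 :> R by rewrite /ord_sign ltnNge ltnW.
rewrite /spin9 (bigD1 a) //= [X in _ + X]big1 => [|c ca]; last first.
  apply: big1 => d cd; rewrite coef_bivec //.
  case: eqP => [/set2_eq[] [cE dE]|_].
  - by rewrite cE eqxx in ca.
  - by move: cd; rewrite cE dE ltnNge ltnW.
  - by rewrite scale0r.
rewrite (bigD1 b) //= big1 => [|d /andP[ad db]]; last first.
  rewrite coef_bivec //; case: eqP => [/set2_eq[] [aE bE]|_].
  - by rewrite bE eqxx in db.
  - by move: ad; rewrite bE ltnn.
  - by rewrite scale0r.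
by rewrite coef_bivec // eqxx sab scale1r !addr0.
Qed.

(** Bilinearity reduces this to bivectors: (I_a I_b)^2 = -1 has trace -16, and products over
    different pairs have trace 0. *)
Lemma mxtrace_spin9 u v : \tr (spin9 I u * spin9 I v) = - 16%:R * dot u v.
Proof.
elim/(@bivec_ind R): v => [x v v' IHv IHv'|c d cd].
  rewrite linearP mulrDr -scalerAr linearP /= IHv IHv' linearP /=.
  by rewrite mulrDr mulrCA.
elim/(@bivec_ind R): u => [x u u' IHu IHu'|a b ab].
  rewrite linearP mulrDl -scalerAl linearP /= IHu IHu' ![dot _ (bivec c d)]dotC.
  by rewrite linearP /= mulrDr mulrCA.
rewrite dot_bivec // !spin9_bivec // coef_bivec //.
case: eqP => [/set2_eq cdE|cdE].
  have -> : I c * I d = ord_sign c d * ord_sign a b *: (I a * I b).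
    case: cdE => -[-> ->]; first by rewrite ord_sign_sqr scale1r.
    by rewrite cliffordC 1?eq_sym // ord_signC // mulNr ord_sign_sqr scaleN1r.
  rewrite -scalerAr linearZ /= mulrA [I a * I b]cliffordC // !mulNr.
  rewrite -[I b * _ * _]mulrA !(clifford_sqr, mulr1).
  by rewrite raddfN /= mxtrace1; ring.
rewrite !mulr0.
have -> : I a * I b * (I c * I d) = cliffprod ([:: a; b] ++ [:: c; d]).
  by rewrite /cliffprod !big_cons big_nil mulr1 !mulrA.
apply: mxtrace_cliffprod_cat => //; first by rewrite /= inE ab.
apply/negP=> /andP[_ /eqP/setP E]; apply: cdE; apply/setP=> k.
by have := E k; rewrite !inE.
Qed.

Lemma dot_bivec_eq0 u : (forall c d, c != d -> dot u (bivec c d) = 0) -> u = 0.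
Proof.
move=> u0; apply/ffunP=> s; rewrite ffunE -coef_val.
have /cards2P[a [b [ab ->]]] : #|val s| == 2%N := valP s.
have := u0 _ _ ab; rewrite dot_bivec // => /eqP.
by rewrite mulf_eq0 signr_eq0 => /eqP.
Qed.

(** Through [mxtrace_spin9] this is cyclicity of the trace. *)
Lemma lie_dotA u v w : dot (lie I u v) w = dot u (lie I v w).
Proof.
have n16 : - 16%:R != 0 :> R by rewrite oppr_eq0 pnatr_eq0.
apply: (mulfI n16); rewrite -!mxtrace_spin9 !spin9_lie // mulmxE mulrBl mulrBr.
rewrite !raddfB /=; congr (_ - _); rewrite ?mulrA //.
by rewrite -[_ * spin9 I u * _]mulrA -mulmxE mxtrace_mulC mulmxE.
Qed.

Lemma lieC u v : lie I v u = - lie I u v.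
Proof. by apply: (spin9_inj hI); rewrite raddfN /= !spin9_lie // opprB. Qed.

Lemma dot_lie u v w : dot (lie I u v) w = - dot v (lie I u w).
Proof. by rewrite -lie_dotA [lie I u v]lieC dotC raddfN /= dotC. Qed.

Lemma lie_bivec_chain a b c : a != b -> b != c -> a != c ->
  lie I (bivec a b) (bivec b c) = 2%:R *: bivec a c.
Proof.
move=> ab bc ac; apply: (spin9_inj hI); rewrite linearZ /= spin9_lie //.
rewrite !spin9_bivec // !mulmxE mulrA.
rewrite -[I a * I b * I b]mulrA clifford_sqr mulr1.
have -> : I b * I c * (I a * I b) = - (I a * I c).
  rewrite mulrA -[I b * I c * I a]mulrA [I c * I a]cliffordC 1?eq_sym //.
  rewrite mulrN mulNr mulrA [I b * I a]cliffordC 1?eq_sym // !mulNr.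
  rewrite -[I a * I b * I c]mulrA [I b * I c]cliffordC // mulrN mulNr.
  by rewrite mulrA -[_ * I b * I b]mulrA clifford_sqr mulr1 opprK.
by rewrite opprK -mulr2n scaler_nat.
Qed.

End Clifford.

(** * Reformulations of the integrability condition *)

Section Integrability.
Context {R : numFieldType}.
Variable I : 'I_9 -> 'M[R]_16.
Hypothesis hI : clifford9 I.
Implicit Types (a b c d : 'I_9) (u v w J : Lambda R 9 2).

(** Since J^2 = -1, the inverse of J is -J and [J, [J, w]] = -2 w - 2 J w J. *)
Lemma AdE J w : T1 I J -> Ad I J w = w + 2%:R^-1 *: lie I J (lie I J w).
Proof.
move=> JJ; apply: (spin9_inj hI).
have JN : spin9 I J *m (- spin9 I J) = 1%:M by rewrite mulmxN JJ opprK.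
have [Ju _] := mulmx1_unit JN.
rewrite spin9_Ad // raddfD /= linearZ /= !spin9_lie // mulmxBr mulmxBl.
have -> : invmx (spin9 I J) = - spin9 I J.
  by rewrite -[RHS]mul1mx -(mulVmx Ju) -mulmxA JN mulmx1.
rewrite !mulmxA JJ -[spin9 I w *m _ *m _]mulmxA JJ.
rewrite !mulmxN mulNmx mul1mx mulmx1.
move: (spin9 I w) (_ *m _) => M1 M2.
by apply/matrixP=> i j; rewrite !mxE; field.
Qed.

(** By [AdE], [J, W w] and W [J, w] occur with both signs and cancel, which leaves the second-order
    parts of the two occurrences of [Ad]. *)
Lemma integrabilityE (W : {linear Lambda R 9 2 -> Lambda R 9 2}) J w :
  T1 I J ->
  lie I J (W (Ad I J w)) - Ad I J (W (lie I J w)) + W (lie I J w)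
    - lie I J (W w) =
  2%:R^-1 *: (lie I J (W (lie I J (lie I J w)))
              - lie I J (lie I J (W (lie I J w)))).
Proof.
move=> TJ; rewrite !AdE // !raddfD /= !linearZ /=.
move: (_ *: - _) => y; move: (_ *: _) => x.
move: (lie _ _ (W w)) => t; move: (W _) => z.
by rewrite -[t + x + _ + z]addrA [- z + y]addrC subrK [t + x]addrC addrAC addrK.
Qed.

Lemma integrability_dot (W : {linear Lambda R 9 2 -> Lambda R 9 2}) J :
  T1 I J ->
  (forall w, lie I J (W (Ad I J w)) - Ad I J (W (lie I J w))
               + W (lie I J w) - lie I J (W w) = 0) <->
  (forall u v, dot (W (lie I J (lie I J u))) (lie I J v) =
               - dot (W (lie I J u)) (lie I J (lie I J v))).
Proof.
move=> TJ; split=> [W0 u v|W0 w].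
  have /eqP := W0 u; rewrite integrabilityE // scaler_eq0 invr_eq0 pnatr_eq0 /=.
  rewrite subr_eq0 => /eqP/(congr1 (fun x => dot x v)).
  by rewrite !(dot_lie hI) => /oppr_inj.
rewrite integrabilityE //; apply/eqP.
rewrite scaler_eq0 subr_eq0; apply/orP; right.
rewrite -subr_eq0; apply/eqP/dot_bivec_eq0 => c d cd.
rewrite dotC raddfB /= ![dot (bivec c d) _]dotC !(dot_lie hI) opprK W0.
by rewrite addrC subrr.
Qed.

(** Write X = [J, u] and Y = [J, v] as matrices. Both anticommute with J, so [J, X] = -2 X J and
    [J, Y] = 2 J Y. The [F] terms on the two sides are then traces of multiples of F X J Y, and the
    [G] terms of G Y J X. *)
Lemma integrability_trace (W : {linear Lambda R 9 2 -> Lambda R 9 2})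
    (F G : 'M[R]_16) :
  (forall u v, dot (W u) v = \tr (F * (spin9 I u * spin9 I v))
                            + \tr (G * (spin9 I v * spin9 I u))) ->
  forall J, T1 I J -> forall u v,
    dot (W (lie I J (lie I J u))) (lie I J v) =
    - dot (W (lie I J u)) (lie I J (lie I J v)).
Proof.
move=> WE J JJ u v.
have lieJ x : spin9 I J * spin9 I (lie I J x) =
    - (spin9 I (lie I J x) * spin9 I J).
  rewrite spin9_lie // !mulmxE mulrBr mulrBl mulrA.
  rewrite -[_ * spin9 I J * spin9 I J]mulrA.
  by rewrite -!mulmxE JJ mulNmx mul1mx mulmxN mulmx1 !mulmxE mulrA opprB addrC.
have lielieJ x : spin9 I (lie I J (lie I J x)) =
    - (spin9 I (lie I J x) * spin9 I J *+ 2).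
  by rewrite spin9_lie // !mulmxE lieJ mulr2n opprD.
have lielieJ' x : spin9 I (lie I J (lie I J x)) =
    spin9 I J * spin9 I (lie I J x) *+ 2.
  by rewrite lielieJ lieJ mulNrn.
rewrite !WE opprD; congr (_ + _); rewrite -raddfN; congr (\tr _);
  rewrite -mulrN; congr (_ * _).
  by rewrite lielieJ lielieJ' mulrnAr mulNr mulrnAl mulrA.
by rewrite (lielieJ v) (lielieJ' u) mulrnAr mulNr mulrnAl mulrA opprK.
Qed.

End Integrability.

(** * Coordinates of the operator w -> ⋆(mu ∧ w) *)

Section HodgeWedge.
Context {R : fieldType}.
Implicit Types (a b c d : 'I_9) (u v w : Lambda R 9 2) (mu : Lambda R 9 5).
Implicit Types (U V : {set 'I_9}).

Definition hodge_wedge mu w : Lambda R 9 2 := hodge (wedge mu w).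

Lemma hodge_wedge_is_linear mu : linear (hodge_wedge mu).
Proof.
have scaleRE (x y : R) : x *: (y : R^o) = x * y by [].
move=> x u v; apply/ffunP=> s; rewrite [LHS]ffunE [RHS]ffunE ![in RHS]ffunE.
have -> : wedge mu (x *: u + v) = x *: wedge mu u + wedge mu v.
  apply/ffunP=> t; rewrite !ffunE scaler_sumr -big_split.
  apply: eq_bigr => S _ /=.
  rewrite scaler_sumr -big_split; apply: eq_bigr => T _ /=.
  rewrite !ffunE !scaleRE !mulrDr; congr (_ + _).
  by rewrite [RHS]mulrCA [X in _ = _ * X]mulrCA.
by rewrite coef_is_linear !scaleRE mulrDr mulrCA.
Qed.

HB.instance Definition _ mu :=
  GRing.isLinear.Build R _ _ _ (hodge_wedge mu) (hodge_wedge_is_linear mu).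

(** In the double sum defining [wedge], only the pair made of U minus {a, b} and {a, b}
    contributes. *)
Lemma coef_wedge_bivec (k : nat) (u : Lambda R 9 k) a b U :
    a != b -> #|U| = (k + 2)%N ->
  coef (wedge u (bivec a b)) U =
  if [set a; b] \subset U then
    shuffle_sign (U :\: [set a; b]) [set a; b] *
      (coef u (U :\: [set a; b]) * ord_sign a b)
  else 0.
Proof.
move=> ab Uk; have [s sU ->] := coef_card (wedge u (bivec a b)) Uk.
rewrite ffunE sU; set P := [set a; b].
have [p pP _] := coef_pair (bivec (R := R) a b) ab.
transitivity (\sum_(S : ksub 9 k | [disjoint val S & P] && (val S :|: P == U))
    shuffle_sign (val S) P * (u S * ord_sign a b)).
  rewrite [RHS]big_mkcond; apply: eq_bigr => S _.
  rewrite big_mkcond (bigD1 p) //=.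
  rewrite pP big1 ?addr0 => [|T Tp]; first by rewrite ffunE pP eqxx.
  by case: ifP => // _; rewrite ffunE -pP val_eqE (negPf Tp) !mulr0.
have SUP (S : {set 'I_9}) : [disjoint S & P] && (S :|: P == U) =
    (P \subset U) && (S == U :\: P).
  apply/andP/andP=> [[SP /eqP <-]|[PU /eqP->]]; split.
  - exact: subsetUr.
  - by rewrite setDUl setDv setU0 eq_sym; apply/eqP/setDidPl.
  - by rewrite disjoints_subset setDE subsetIr.
  - by rewrite setDE setUIl [~: P :|: P]setUC setUCr setIT; apply/eqP/setUidPl.
under eq_bigl do rewrite SUP.
case: (boolP (P \subset U)) => PU /=; last by rewrite big_pred0.
have Dk : #|U :\: P| = k.
  by rewrite cardsD (setIidPr PU) Uk cards2 ab addnK.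
have [t tD ->] := coef_card u Dk.
rewrite (big_pred1 t) ?tD // => S.
by rewrite -tD val_eqE.
Qed.

(** The value is the 4-form ⋆mu on (e_a, e_b, e_c, e_d). The signs of the wedge product and of the
    Hodge operator combine by [shuffle_signA], applied to the complement of {a, b, c, d}, {a, b} and
    {c, d}. *)
Lemma dot_hodge_wedge mu a b c d : a != b -> c != d ->
  dot (hodge_wedge mu (bivec a b)) (bivec c d) =
  if uniq [:: a; b; c; d] then
    let V := [set x in [:: a; b; c; d]] in
    inv_sign [:: a; b; c; d] * (shuffle_sign (~: V) V * coef mu (~: V))
  else 0.
Proof.
move=> ab cd; rewrite dot_bivec //.
have [s sT ->] := coef_pair (hodge_wedge mu (bivec a b)) cd.
rewrite ffunE.
have U7 : #|~: [set c; d]| = (5 + 2)%N.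
  by rewrite cardsCs setCK cards2 cd card_ord.
rewrite sT coef_wedge_bivec //.
have uniqE : uniq [:: a; b; c; d] = ([set a; b] \subset ~: [set c; d]).
  rewrite /= !inE (negPf ab) cd /= subUset !sub1set !inE /=.
  by do 4!case: (_ == _).
rewrite -uniqE; case: ifP => u; last by rewrite !mulr0.
rewrite (inv_sign_shuffle (p := [:: a; b]) (q := [:: c; d])) /= ?inE ?ab ?cd //.
have -> : [set x in [:: a; b; c; d]] = [set a; b] :|: [set c; d].
  by apply/setP=> x; rewrite !inE -!orbA.
have -> : [set x in [:: a; b]] = [set a; b] by apply/setP=> x; rewrite !inE.
have -> : [set x in [:: c; d]] = [set c; d] by apply/setP=> x; rewrite !inE.
have -> : ~: [set c; d] :\: [set a; b] = ~: ([set a; b] :|: [set c; d]).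
  by rewrite setDE [RHS]setCU setIC.
set P := [set a; b] in uniqE *; set T := [set c; d] in uniqE *.
rewrite u in uniqE.
have PT : [disjoint P & T] by rewrite disjoints_subset -uniqE.
have VP : [disjoint ~: (P :|: T) & P].
  by rewrite disjoint_sym disjoints_subset setCK subsetUl.
have := shuffle_signA (R := R) VP PT.
have -> : ~: (P :|: T) :|: P = ~: T.
  rewrite setCU setUIl [~: P :|: P]setUC setUCr setTI.
  by apply/setUidPl; rewrite -uniqE.
rewrite !big_cons !big_nil !mulr1.
have := shuffle_sign_sqr (R := R) P T.
move: (shuffle_sign _ _) (shuffle_sign P T) (shuffle_sign _ P).
move: (shuffle_sign _ (_ :|: _)) => t x y z yy E.
by ring: E yy.
Qed.

End HodgeWedge.

(** * Sufficiency: the three kinds of operators as trace forms *)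

Section Sufficiency.
Context {R : numFieldType}.
Variable I : 'I_9 -> 'M[R]_16.
Hypothesis hI : clifford9 I.
Implicit Types (a b c d : 'I_9) (l : seq 'I_9) (u v w : Lambda R 9 2).

Lemma cliffprod_sqr_cons a l : a \notin l ->
  cliffprod I (a :: l) * cliffprod I (a :: l) =
  (-1) ^+ size l *: (cliffprod I l * cliffprod I l).
Proof.
move=> al; rewrite /cliffprod big_cons -/(cliffprod I l).
rewrite {1}(cliffprod_comm hI) (count_memPn al) addn0 -scalerAl; congr (_ *: _).
by rewrite mulrA -[_ * I a * I a]mulrA (clifford_sqr hI) mulr1.
Qed.

Lemma hodge_wedge_trace mu :
  exists F : 'M[R]_16, forall u v,
    dot (hodge_wedge mu u) v = \tr (F * (spin9 I u * spin9 I v)).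
Proof.
have [Q QE] := alternatingE (cliffprod_alternating hI).
(* [nu] lists the coefficients of ⋆mu. The factor 1/16 in the witness offsets the trace 16 of the
   identity. *)
pose nu (V : {set 'I_9}) : R := shuffle_sign (~: V) V * coef mu (~: V).
exists (\sum_(s : ksub 9 4) (16%:R^-1 * nu (val s)) *: Q (val s)) => u v.
elim/(@bivec_ind R): v => [x v v' IHv IHv'|c d cd].
  by rewrite !linearP /= IHv IHv' mulrDr mulrDr -!scalerAr linearP.
elim/(@bivec_ind R): u => [x u u' IHu IHu'|a b ab].
  rewrite !linearP /= dotC linearP /= dotC IHu.
  rewrite [dot _ (hodge_wedge mu u')]dotC IHu'.
  by rewrite mulrDl mulrDr -scalerAl -scalerAr linearP.
rewrite !spin9_bivec // dot_hodge_wedge //.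
set l := [:: a; b; c; d].
have -> : I a * I b * (I c * I d) = cliffprod I l.
  by rewrite /cliffprod !big_cons big_nil mulr1 !mulrA.
have Qcliff m : uniq m -> Q [set x in m] = inv_sign m *: cliffprod I m.
  by move=> um; rewrite QE // scalerA inv_sign_sqr scale1r.
have trQ (s : ksub 9 4) : \tr (Q (val s) * cliffprod I l) =
    if uniq l && (val s == [set x in l]) then inv_sign l * 16%:R else 0.
  case: ifP => [/andP[ul /eqP->]|sl].
    rewrite Qcliff // -scalerAl linearZ /=; congr (_ * _).
    move: (ul) => /= /and4P[al bl cl _].
    (* The sign exponents 3, 2, 1, 0 have even sum, so a product of four distinct generators squares
       to 1. *)
    rewrite !cliffprod_sqr_cons // /cliffprod big_nil mulr1 !scalerA /=.
    by rewrite -!exprD -signr_odd /= scale1r mxtrace1.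
  have sE : val s = [set x in enum (val s)].
    by apply/setP=> x; rewrite inE mem_enum.
  have s4 : size (enum (val s)) = size l by rewrite -cardE; apply/eqP/(valP s).
  rewrite [X in Q X]sE Qcliff ?enum_uniq // -scalerAl linearZ /= -cliffprod_cat.
  by rewrite (mxtrace_cliffprod_cat hI) ?enum_uniq ?mulr0 // -sE sl.
have -> : \tr ((\sum_(s : ksub 9 4) (16%:R^-1 * nu (val s)) *: Q (val s)) *
                cliffprod I l) =
    \sum_(s : ksub 9 4) 16%:R^-1 * nu (val s) *
      (if uniq l && (val s == [set x in l]) then inv_sign l * 16%:R else 0).
  rewrite mulr_suml raddf_sum; apply: eq_bigr => s _.
  by rewrite -trQ -scalerAl /= mxtraceZ.
(* With a repeated index every trace vanishes, matching the zero branch of [dot_hodge_wedge]. *)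
case: ifP => ul; last by rewrite big1 // => s _; rewrite mulr0.
have l4 : #|[set x in l]| = 4%N by rewrite cardsE (card_uniqP ul).
have [s sE _] := coef_card (0 : Lambda R 9 4) l4.
rewrite (bigD1 s) // big1 => [|t ts]; last first.
  by rewrite -sE val_eqE (negPf ts) mulr0.
rewrite sE eqxx -[LHS]/(inv_sign l * nu [set x in l]).
by move: (nu _) (inv_sign l) => x y /=; field.
Qed.

Lemma dot_trace u v : dot u v = - 16%:R^-1 * \tr (spin9 I u * spin9 I v).
Proof. by rewrite (mxtrace_spin9 hI); field. Qed.

Lemma integrability_sufficient (W : {linear Lambda R 9 2 -> Lambda R 9 2})
    (x : R) (eta : Lambda R 9 2) (mu : Lambda R 9 5) :
  (forall w, W w = x *: w + lie I eta w + hodge_wedge mu w) ->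
  forall J, T1 I J -> forall u v,
    dot (W (lie I J (lie I J u))) (lie I J v) =
    - dot (W (lie I J u)) (lie I J (lie I J v)).
Proof.
move=> WE; have [F FE] := hodge_wedge_trace mu.
pose k : R := 16%:R^-1.
(* By [dot_trace], x u + [eta, u] contributes -1/16 times the trace of (x u + eta u - u eta) v;
   cyclicity turns the trace of u eta v into that of eta v u, which gives [G]. *)
apply: (integrability_trace hI (F := - k *: (x%:A + spin9 I eta) + F)
                            (G := k *: spin9 I eta)) => u v.
have lieE : dot (lie I eta u) v =
    - k * (\tr (spin9 I eta * (spin9 I u * spin9 I v))
           - \tr (spin9 I eta * (spin9 I v * spin9 I u))).
  rewrite dot_trace spin9_lie // mulmxE mulrBl raddfB /=; congr (_ * (_ - _)).
    by rewrite mulrA.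
  by rewrite -mulrA -mulmxE mxtrace_mulC !mulmxE mulrA.
rewrite WE dotC !raddfD /= linearZ /= ![dot v _]dotC FE lieE dot_trace -/k.
rewrite !mulrDl !linearD /= -!scalerAl !linearZ /= mul1r.
by move: (\tr _) (\tr _) (\tr _) (\tr _) => t1 t2 t3 t4; ring.
Qed.

End Sufficiency.

(** * Necessity: recovering c, eta and mu from the entries of W *)

Section Necessity.
Context {R : numFieldType}.
Variable I : 'I_9 -> 'M[R]_16.
Hypothesis hI : clifford9 I.
Implicit Types (a b c d : 'I_9) (l : seq 'I_9) (u v w : Lambda R 9 2).

Lemma T1_bivec a b : a != b -> T1 I (bivec a b).
Proof.
move=> ab; rewrite /T1 (spin9_bivec hI) // mulmxE mulrA [I a * I b]cliffordC //.
by rewrite !mulNr -[I b * _ * _]mulrA !(clifford_sqr hI, mulr1).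
Qed.

Lemma lie_bivec_common a b c : a != b -> b != c -> a != c ->
  lie I (bivec a b) (bivec a c) = - 2%:R *: bivec b c.
Proof.
move=> ab bc ac; have lieNl u v : lie I (- u) v = - lie I u v.
  by rewrite lieC // linearN /= [lie I v u]lieC // opprK.
by rewrite [bivec a b]bivecC lieNl lie_bivec_chain ?scaleNr // eq_sym.
Qed.

Let lie_lie_chain a b c : a != b -> b != c -> a != c ->
  lie I (bivec a b) (lie I (bivec a b) (bivec b c)) = - 4%:R *: bivec b c.
Proof.
move=> ab bc ac; rewrite lie_bivec_chain // linearZ /= lie_bivec_common //.
by rewrite scalerA mulrN -natrM.
Qed.

Let lie_lie_common a b c : a != b -> b != c -> a != c ->
  lie I (bivec a b) (lie I (bivec a b) (bivec a c)) = - 4%:R *: bivec a c.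
Proof.
move=> ab bc ac; rewrite lie_bivec_common // linearZ /= lie_bivec_chain //.
by rewrite scalerA mulNr -natrM.
Qed.

Lemma lie_bivec_disjoint a b c d : uniq [:: a; b; c; d] ->
  lie I (bivec a b) (bivec c d) = 0.
Proof.
rewrite /= !inE !negb_or -!andbA => /and5P[ab ac ad bc /and3P[bd cd _]].
apply: (spin9_inj hI); rewrite spin9_lie // raddf0 !(spin9_bivec hI) // mulmxE.
apply/eqP; rewrite subr_eq0; apply/eqP.
rewrite mulrA -[I a * I b * I c]mulrA [I b * I c](cliffordC hI) //.
rewrite mulrN mulNr mulrA [I a * I c](cliffordC hI) // !mulNr opprK.
rewrite -mulrA [I b * I d](cliffordC hI) // mulrN -[I c * I a * _]mulrA.
rewrite [I a * (_ * _)]mulrA [I a * I d](cliffordC hI) //.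
by rewrite mulNr mulrN opprK !mulrA.
Qed.

Lemma alternating_dot (phi : seq 'I_9 -> R^o) : alternating phi ->
  exists eta, forall a b, a != b -> dot eta (bivec a b) = phi [:: a; b].
Proof.
case/alternatingE=> N phiE; exists [ffun s => N (val s)] => a b ab.
have [s sE cE] := coef_pair [ffun s : ksub 9 2 => N (val s) : R^o] ab.
rewrite dot_bivec // cE ffunE sE phiE /= ?inE ?ab //.
rewrite big_seq1 big_nil !mulr1; congr (_ *: N _).
by apply/setP=> x; rewrite !inE.
Qed.

(** The witness inverts the Hodge operator: its shuffle sign cancels the one in
    [dot_hodge_wedge]. *)
Lemma alternating_hodge_wedge (phi : seq 'I_9 -> R^o) : alternating phi ->
  exists mu, forall a b c d, uniq [:: a; b; c; d] ->
    dot (hodge_wedge mu (bivec a b)) (bivec c d) = phi [:: a; b; c; d].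
Proof.
case/alternatingE=> N phiE.
exists [ffun s => shuffle_sign (val s) (~: val s) * N (~: val s)] => a b c d u.
have [ab cd] : a != b /\ c != d.
  by move: u; rewrite /= !inE !negb_or -!andbA => /and5P[? _ _ _ /and3P[]].
rewrite dot_hodge_wedge // u phiE //=; set V := [set x in _].
have V5 : #|~: V| = 5%N by rewrite cardsCs setCK cardsE (card_uniqP u) card_ord.
congr (_ * _).
set mu := finfun _; have [s sE ->] := coef_card mu V5.
by rewrite ffunE sE setCK mulrA shuffle_sign_sqr mul1r.
Qed.

(** The pairs {a, b} and {c, d} share two, one or no indices; reversing orientations brings a shared
    index to the first place. *)
Lemma bivec_pairs_ind (P : Lambda R 9 2 -> Lambda R 9 2 -> Prop) :
  (forall u v, P u v -> P (- u) v) -> (forall u v, P u v -> P u (- v)) ->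
  (forall a b, a != b -> P (bivec a b) (bivec a b)) ->
  (forall a b c, uniq [:: a; b; c] -> P (bivec a b) (bivec a c)) ->
  (forall a b c d, uniq [:: a; b; c; d] -> P (bivec a b) (bivec c d)) ->
  forall a b c d, a != b -> c != d -> P (bivec a b) (bivec c d).
Proof.
move=> PNl PNr P2 P3 P4 a b c d ab cd.
have share x y z : x != y -> x != z -> P (bivec x y) (bivec x z).
  move=> xy xz; have [<-|yz] := eqVneq y z; first exact: P2.
  by apply: P3; rewrite /= !inE negb_or xy xz yz.
have [ac|ac] := eqVneq a c; first by rewrite -ac; apply: share; rewrite // ac.
have [ad|ad] := eqVneq a d.
  rewrite [bivec c d]bivecC -ad; apply: PNr.
  by apply: share; rewrite // eq_sym ad eq_sym.
have [bc|bc] := eqVneq b c.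
  rewrite [bivec a b]bivecC -bc; apply: PNl.
  by apply: share; rewrite 1?eq_sym // bc eq_sym.
have [bd|bd] := eqVneq b d.
  rewrite [bivec a b]bivecC [bivec c d]bivecC -bd; apply: PNl; apply: PNr.
  by apply: share; rewrite 1?eq_sym // bd.
by apply: P4; rewrite /= !inE !negb_or ab ac ad bc bd cd.
Qed.

Variable W : {linear Lambda R 9 2 -> Lambda R 9 2}.
Hypothesis integrable : forall J, T1 I J -> forall u v,
  dot (W (lie I J (lie I J u))) (lie I J v) =
  - dot (W (lie I J u)) (lie I J (lie I J v)).

Let g a b c d : R := dot (W (bivec a b)) (bivec c d).

Let g_flipl a b c d : g a b c d = - g b a c d.
Proof. by rewrite /g bivecC raddfN /= dotC raddfN /= dotC. Qed.

Let g_flipr a b c d : g a b c d = - g a b d c.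
Proof. by rewrite /g [bivec c d]bivecC raddfN. Qed.

Let dotZZ x y u v : dot (W (x *: u)) (y *: v) = x * y * dot (W u) v.
Proof. by rewrite [W _]linearZ /= dotC linearZ /= dotC linearZ /= mulrA. Qed.

(** With J = e_a ∧ e_b, u = e_b ∧ e_c and v = e_b ∧ e_d, each side of the condition carries a factor
    of absolute value 4 · 2 = 8. The case c = d is included and serves in [g2_alternating]. *)
Let g_swap a b c d : a != b -> a != c -> b != c -> a != d -> b != d ->
  g a c b d = - g b c a d.
Proof.
move=> ab ac bc ad bd; have := integrable (T1_bivec ab) (bivec b c) (bivec b d).
rewrite !lie_lie_chain // !lie_bivec_chain // !dotZZ => E.
have n8 : 8%:R != 0 :> R by rewrite pnatr_eq0.
by apply: (mulfI n8); rewrite /g; ring: E.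
Qed.

(** Same J and u, now with v = e_a ∧ e_d. The case c = d gives the steps of [g_diag]. *)
Let g_shift a b c d : a != b -> a != c -> b != c -> a != d -> b != d ->
  g a c a d = g b c b d.
Proof.
move=> ab ac bc ad bd; have := integrable (T1_bivec ab) (bivec b c) (bivec a d).
rewrite lie_lie_chain // lie_lie_common // lie_bivec_chain //.
rewrite lie_bivec_common // !dotZZ => E.
have n8 : 8%:R != 0 :> R by rewrite pnatr_eq0.
by apply: (mulfI n8); rewrite /g; ring: E.
Qed.

(** [g_shift] replaces one index of the pair at a time: {a, b}, {c, b}, {c, d}. If b = c, a single
    replacement suffices. *)
Let g_diag a b c d : a != b -> c != d -> g a b a b = g c d c d.
Proof.
have step x y z : x != y -> z != y -> g x y x y = g z y z y.
  move=> xy zy; have [->//|xz] := eqVneq x z; exact: g_shift.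
have flip x y : g x y x y = g y x y x by rewrite g_flipl g_flipr opprK.
move=> ab cd; have dc : d != c by rewrite eq_sym.
have [bc|bc] := eqVneq b c.
  by rewrite (step a b d) ?[g d b d b]flip ?bc // -bc.
rewrite (step a b c) ?[g c b c b]flip ?(step b c d) ?[g d c d c]flip //.
by rewrite eq_sym.
Qed.

Let g4 l : R^o := if l is [:: a; b; c; d] then g a b c d else 0.

(** The outer transpositions hold by antisymmetry of 2-forms; only the middle one, [mid], rests on
    integrability, through [g_swap]. On lists of other lengths [g4] is 0. *)
Let g4_alternating : alternating g4.
Proof.
have mid a b c d : uniq [:: a; b; c; d] -> g a b c d = - g a c b d.
  rewrite /= !inE !negb_or -!andbA => /and5P[ab ac ad bc /and3P[bd cd _]].
  by rewrite g_flipl g_swap // 1?eq_sym // g_flipl opprK.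
case=> [|p1 [|p2 [|p3 [|p4 [|p5 p]]]]] x y [|q1 [|q2 [|q3 q]]] //= u;
  rewrite ?oppr0 //; exact: mid.
Qed.

Let third b c : exists a, a \notin [:: b; c].
Proof.
apply/existsP; apply: contraT; rewrite negb_exists => /forallP H.
have /subset_leq_card : [set: 'I_9] \subset [:: b; c].
  by apply/subsetP=> x _; have := H x; rewrite negbK.
by rewrite cardsT card_ord => /leq_trans/(_ (card_size _)).
Qed.

(** The coefficients of eta, read off with an arbitrary third index. The factor -1/2 undoes the -2
    of [lie_bivec_common]. *)
Let g2 l : R^o :=
  if l is [:: b; c] then
    - 2%:R^-1 * g (xchoose (third b c)) b (xchoose (third b c)) c
  else 0.

Let g2E a b c : uniq [:: a; b; c] -> g2 [:: b; c] = - 2%:R^-1 * g a b a c.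
Proof.
rewrite /= !inE negb_or -!andbA => /and4P[ab ac bc _]; congr (_ * _).
have := xchooseP (third b c); set k := xchoose _.
rewrite !inE negb_or => /andP[kb kc].
have [->//|ka] := eqVneq k a; exact: g_shift.
Qed.

Let g2_alternating : alternating g2.
Proof.
move=> [|p1 [|p2 [|p3 p]]] b c [|q1 q] //= u; rewrite ?oppr0 //.
have bc : b != c by move: u; rewrite inE andbT.
have [a] := third b c; rewrite !inE negb_or => /andP[ab ac].
have abc : uniq [:: a; b; c] by rewrite /= !inE negb_or ab ac bc.
have acb : uniq [:: a; c; b] by rewrite /= !inE negb_or ab ac eq_sym bc.
rewrite -[LHS]/(g2 [:: b; c]) -[X in - X]/(g2 [:: c; b]) (g2E abc) (g2E acb).
have [ba ca] : b != a /\ c != a by rewrite ![_ == a]eq_sym.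
by rewrite g_flipl g_flipr opprK g_swap // g_flipl g_flipr opprK mulrN.
Qed.

(** W and the candidate [V] are compared on pairs of bivectors. Only the x term of [V] survives for
    equal pairs, only the eta term for one shared index, and only the mu term for disjoint pairs. *)
Lemma integrability_necessary : exists x eta mu,
  forall w, W w = x *: w + lie I eta w + hodge_wedge mu w.
Proof.
have [eta etaE] := alternating_dot g2_alternating.
have [mu muE] := alternating_hodge_wedge g4_alternating.
pose x := g 0 1 0 1; exists x, eta, mu.
pose V w := x *: w + lie I eta w + hodge_wedge mu w.
have Vlin y u v : V (y *: u + v) = y *: V u + V v.
  rewrite /V !linearP /= !scalerDr.
  by rewrite [RHS]addrACA [X in _ = X + _]addrACA.
have VN u : V (- u) = - V u.
  have V0 : V 0 = 0 by rewrite /V scaler0 !raddf0 !addr0.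
  by rewrite -[- u]addr0 -scaleN1r Vlin V0 addr0 scaleN1r.
(* Invariance isolates eta, so that only brackets of bivectors remain to be computed. *)
have dotV u v : dot (V u) v =
    x * dot u v + dot eta (lie I u v) + dot (hodge_wedge mu u) v.
  by rewrite dotC !raddfD /= linearZ /= !(dotC v) lie_dotA.
have key a b c d : a != b -> c != d ->
    dot (W (bivec a b)) (bivec c d) = dot (V (bivec a b)) (bivec c d).
  pose P u v := dot (W u) v = dot (V u) v.
  move: a b c d; apply: (bivec_pairs_ind (P := P))
    => [u v E|u v E|a b ab|a b c abc|a b c d abcd]; rewrite /P.
  - by rewrite raddfN VN ![dot (- _) _]dotC !raddfN /= ![dot v _]dotC E.
  - by rewrite !raddfN /= E.
  - rewrite dotV dot_hodge_wedge //= !inE eqxx /= orbT /= addr0.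
    rewrite (dot_bivec (bivec a b)) // coef_bivec // eqxx ord_sign_sqr mulr1.
    have -> : lie I (bivec a b) (bivec a b) = 0.
      by apply: (spin9_inj hI); rewrite spin9_lie // subrr raddf0.
    by rewrite raddf0 addr0; apply: g_diag.
  - move: (abc); rewrite /= !inE negb_or -!andbA => /and4P[ab ac bc _].
    rewrite dotV dot_hodge_wedge //= !inE eqxx /= orbT /= addr0.
    rewrite (dot_bivec (bivec a b)) // coef_bivec // lie_bivec_common //.
    rewrite linearZ /= etaE //.
    case: eqP => [/set2_eq[[_ cb]|[ac' _]]|_].
    + by rewrite cb eqxx in bc.
    + by rewrite -ac' eqxx in ab.
    by rewrite (g2E abc) !mulr0 add0r -/(g a b a c); field.
  - move: (abcd); rewrite /= !inE !negb_or -!andbA.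
    move=> /and5P[ab ac ad bc /and3P[bd cd _]].
    rewrite dotV lie_bivec_disjoint // raddf0 muE //.
    rewrite (dot_bivec (bivec a b)) // coef_bivec //.
    case: eqP => [/set2_eq[[ca _]|[cb _]]|_].
    + by rewrite ca eqxx in ac.
    + by rewrite cb eqxx in bc.
    by rewrite !mulr0 !add0r.
elim/(@bivec_ind R) => [y u v IHu IHv|a b ab].
  by rewrite linearP /= IHu IHv; apply/esym/Vlin.
apply/eqP; rewrite -subr_eq0; apply/eqP/dot_bivec_eq0 => c d cd.
by rewrite dotC raddfB /= dotC key // [X in _ - X]dotC subrr.
Qed.

End Necessity.

Theorem theorem2 (R : realType) (I : 'I_9 -> 'M[R]_16) (hI : clifford9 I)
    (W22 : {linear Lambda R 9 2 -> Lambda R 9 2}) :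
  (forall (w : Lambda R 9 2) (J : Lambda R 9 2), T1 I J ->
     lie I J (W22 (Ad I J w)) - Ad I J (W22 (lie I J w))
       + W22 (lie I J w) - lie I J (W22 w) = 0) <->
  (exists (c : R) (eta : Lambda R 9 2) (mu : Lambda R 9 5),
     forall w : Lambda R 9 2,
       W22 w = c *: w + lie I eta w + hodge (wedge mu w)).
Proof.
split=> [W0|[c [eta [mu WE]]] w J TJ].
  apply: (integrability_necessary hI) => J TJ u v.
  by apply: (integrability_dot hI W22 TJ).1 => w; apply: W0.
apply: (integrability_dot hI W22 TJ).2.
exact: (integrability_sufficient hI (mu := mu) WE TJ).
Qed.
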